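(* Let $k\ge 1$ be a fixed integer and let $1/2\le\lambda\le 1$ be fixed. Let $\Sigma=(a_1,\dots,a_n)$ be an $\mathcal{F}_{\lambda,n}$-sum distinct sequence in $\mathbb{Z}^k$ that is $M$-bounded. Then, as $n\to\infty$, $$ M \geq (1+o(1)) \cdot \begin{cases} \sqrt{\dfrac{4}{\pi n (k+2)}} \cdot \Gamma(k/2+1)^{1/k} \cdot 2^{n/k} & \text{if } \lambda=1; \\[2mm] \sqrt{\dfrac{4}{\pi n (k+2)}} \cdot \Gamma(k/2+1)^{1/k} \cdot 2^{(n-1)/k} & \text{if } 1/2 \leq \lambda < 1, \end{cases} $$ where $\Gamma$ is the gamma function.
   Context: $\mathcal{F}_{\lambda,n}$ denotes the family of all subsets of $\{1,\dots,n\}$ of size at most $\lambda n$. A sequence $\Sigma=(a_1,\dots,a_n)$ in $\mathbb{Z}^k$ is $M$-bounded if $a_i\in[0,M]^k$ for all $i$. For $A\subseteq\{1,\dots,n\}$ put $S(A)=\sum_{i\in A}a_i$. The sequence is $\mathcal{F}_{\lambda,n}$-sum distinct if $S(A_1)\neq S(A_2)$ for all distinct $A_1,A_2\in\mathcal{F}_{\lambda,n}$. The $o(1)$ is a quantity depending only on $n,k,\lambda$ (not on $\Sigma$ or $M$) that tends to $0$ as $n\to\infty$ with $k,\lambda$ fixed; i.e. for every $\varepsilon>0$ there is $N$ such that for all $n\ge N$ and every such $\Sigma$ and $M$ the inequality holds with $1+o(1)$ replaced by $1-\varepsilon$. *)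

(* Defs.v *)
From HB Require Import structures.
From mathcomp Require Import all_boot all_order all_algebra.
From mathcomp Require Import all_classical all_reals all_analysis.

Set Implicit Arguments.
Unset Strict Implicit.
Unset Printing Implicit Defensive.

Import Order.TTheory GRing.Theory Num.Theory.
Import numFieldNormedType.Exports.

Local Open Scope classical_set_scope.
Local Open Scope ring_scope.

(* Euler's integral; meaningful for x > 0, where the integral converges
   ([Rintegral] is 0 when the integral is infinite). *)
Definition Gamma (R : realType) (x : R) : R :=
  \int[lebesgue_measure]_(t in `]0, +oo[%classic) (t `^ (x - 1) * expR (- t)).

(* The index set {1, ..., n} is rendered as 'I_n throughout. *)
Definition small_subsets (R : realType) (lam : R) (n : nat) : {set {set 'I_n}} :=
  [set A : {set 'I_n} | (#|A|%:R <= lam * n%:R :> R)]%SET.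

Definition subset_sum (n k : nat) (a : 'I_n -> 'rV[int]_k) (A : {set 'I_n}) :
    'rV[int]_k :=
  \sum_(i in A) a i.

Definition sum_distinct (n k : nat) (F : {set {set 'I_n}})
    (a : 'I_n -> 'rV[int]_k) : Prop :=
  forall A1 A2 : {set 'I_n}, A1 \in F -> A2 \in F ->
    A1 <> A2 -> subset_sum a A1 <> subset_sum a A2.

Definition bounded_seq (R : realType) (n k : nat) (M : R)
    (a : 'I_n -> 'rV[int]_k) : Prop :=
  forall (i : 'I_n) (j : 'I_k), 0 <= ((a i 0 j)%:~R : R) <= M.

Definition main_term (R : realType) (k : nat) (lam : R) (n : nat) : R :=
  if lam == 1 then
    Num.sqrt (4 / (pi * n%:R * (k%:R + 2))) *
      Gamma (k%:R / 2 + 1) `^ (1 / k%:R) * 2 `^ (n%:R / k%:R)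
  else
    Num.sqrt (4 / (pi * n%:R * (k%:R + 2))) *
      Gamma (k%:R / 2 + 1) `^ (1 / k%:R) * 2 `^ ((n%:R - 1) / k%:R).

(* Main.v *)
Require Import Defs.
From HB Require Import structures.
From mathcomp Require Import all_boot all_order all_algebra.
From mathcomp Require Import all_classical all_reals all_analysis.
From mathcomp Require Import measurable_realfun.
From mathcomp Require Import ring lra.

Import Order.TTheory GRing.Theory Num.Theory.
Import numFieldNormedType.Exports.

Local Open Scope ring_scope.
Local Notation mu := lebesgue_measure.

(** The proof is the variance method: the subset sums cannot all lie close to
    their mean, because they are distinct lattice points, and cannot all lie
    far from it, because their variance is small.

    Let [G] be a family of subsets on which the sums are distinct and which is
    balanced under complementation: all subsets when [lam = 1], and one set
    from each complementary pair, of size at most [n / 2], otherwise.  Put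
    [m = #|G|] and let [c] be half of the total sum.  Complementing [A]
    changes the sign of [S(A) - c], so the average of [|S(A) - c|^2] over [G]
    equals the one over all subsets; that is the variance of a sum of
    independent random signs, which is at most [n k M^2 / 4]
    ([sum_deviation_le]).

    In the other direction, the points [S(A) - c] are [m] distinct points of
    a translate of [Z^k], so unit cubes around them are disjoint and their
    second moment is, up to an additive [k / 12] per point, at least that of
    a ball of volume [m].  This is used in the dual form
<<
      sum_x (T - |x|^2)_+ <= C_k (T + k/12)_+^(k/2+1),
      C_k = int (1 - |y|^2)_+ dy,
>>
    where [x] runs over distinct points of the translate
    ([sum_over_lattice]).  It is proved one coordinate at a time: the sum
    over the last coordinate of [(T - z^2)_+^p] is compared with an integral
    by convexity on each unit interval ([sum_over_line]).  Hence only
    one-dimensional integrals occur, and [C_k] is a product of integrals of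
    powers of the cosine on [[-pi/2, pi/2]].  The recursion of these
    integrals, compared with that of the moments of the Gaussian, gives
    [C_k (k/2+1) Gamma(k/2+1) = pi^(k/2)] ([Gamma_half]).

    With [T + k/12 = r^2], where [r] is the radius of the ball of volume [m],
    the two estimates combine into
    [M^2 >= 4 r^2 / (n (k+2)) - 1 / (3 n)] ([sum_distinct_sqr_bound]).  The
    first term on the right is the square of the main term, and since
    [r] tends to infinity with [n], the second is eventually at most [eps]
    times the first. *)

(** * Integrals of continuous functions and powers of the cosine *)

Lemma continuous_integrable {R : realType} (f : R -> R) (a b : R) :
  continuous f -> (mu : measure _ R).-integrable `[a, b]%classic (EFin \o f).
Proof.
move=> cf; apply: continuous_compact_integrable; first exact: segment_compact.
exact: continuous_subspaceT.
Qed.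

Lemma Rintegral_antiderivative {R : realType} (F f : R -> R) (a b : R) :
  a <= b -> (forall x : R, is_derive x (1 : R) F (f x)) -> continuous f ->
  \int[mu]_(x in `[a, b]%classic) f x = F b - F a.
Proof.
rewrite le_eqVlt => /predU1P[<- _ _|ab dF cf].
  by rewrite set_itv1 Rintegral_set1 subrr.
have cF : continuous F.
  by move=> x; apply/differentiable_continuous/derivable1_diffP; apply: ex_derive.
rewrite /Rintegral (@continuous_FTC2 _ f F)//.
- exact: continuous_subspaceT.
- split; first by move=> x _; apply: ex_derive.
  + apply: cvg_at_right_filter; exact: cF.
  + apply: cvg_at_left_filter; exact: cF.
- by move=> x _; rewrite derive1E derive_val.
Qed.

(** Slicing the kernel [(1 - |y|^2)_+^p] along a coordinate produces these
    integrals, after the substitution [y = sin t]. *)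
Definition wallis (R : realType) (n : nat) : R :=
  \int[mu]_(x in `[- (pi / 2), pi / 2]%classic) (cos x ^+ n).

Lemma pihalf_ge0 {R : realType} : 0 <= pi / 2 :> R.
Proof. by rewrite divr_ge0 ?pi_ge0. Qed.

Lemma wallis0 (R : realType) : wallis R 0 = pi.
Proof.
rewrite /wallis (@Rintegral_antiderivative _ id (fun=> 1)).
- by field.
- by have := @pihalf_ge0 R; lra.
- exact: cst_continuous.
Qed.

Lemma wallis1 (R : realType) : wallis R 1 = 2.
Proof.
rewrite /wallis (@Rintegral_antiderivative _ sin (fun x => cos x ^+ 1)).
- by rewrite sinN sin_pihalf; ring.
- by have := @pihalf_ge0 R; lra.
- by move=> x; exact: continuous_cos.
Qed.

Lemma continuous_cosX {R : realType} (n : nat) : continuous (fun x : R => cos x ^+ n).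
Proof.
move=> x; apply: (@continuous_comp _ _ _ cos (fun y => y ^+ n)).
  exact: continuous_cos.
exact: exprn_continuous.
Qed.

Lemma wallis_ge0 (R : realType) (n : nat) : 0 <= wallis R n.
Proof.
apply: Rintegral_ge0 => t /=; rewrite in_itv/= => tpi.
by rewrite exprn_ge0// cos_ge0_pihalf.
Qed.

(** The function [sin * cos ^+ n.+1] vanishes at both ends of the interval,
    and its derivative is [n.+2 * cos ^+ n.+2 - n.+1 * cos ^+ n]. *)
Lemma wallisS (R : realType) (n : nat) :
  n.+2%:R * wallis R n.+2 = n.+1%:R * wallis R n.
Proof.
pose f (x : R) := n.+2%:R * cos x ^+ n.+2 - n.+1%:R * cos x ^+ n.
have c1 : continuous (fun x : R => n.+2%:R * cos x ^+ n.+2).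
  by move=> x; apply: cvgM; [exact: cvg_cst|exact: continuous_cosX].
have c2 : continuous (fun x : R => n.+1%:R * cos x ^+ n).
  by move=> x; apply: cvgM; [exact: cvg_cst|exact: continuous_cosX].
have cf : continuous f by move=> x; apply: cvgB; [exact: c1|exact: c2].
have dF (x : R) : is_derive x (1 : R) (sin * cos ^+ n.+1 : R -> R) (f x).
  apply: (is_derive_eq (is_deriveM (is_derive_sin x)
                                   (is_deriveX n.+1 (is_derive_cos x)))).
  have h := cos2Dsin2 x; rewrite /f /GRing.scale /= fctE /=.
  rewrite (_ : sin x * _ = - n.+1%:R * cos x ^+ n * (sin x ^+ 2)); last by ring.
  by rewrite -(addKr (cos x ^+ 2) (sin x ^+ 2)) h -!natr1 !exprS; ring.
have : \int[mu]_(x in `[- (pi / 2), pi / 2]%classic) f x = 0.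
  rewrite (Rintegral_antiderivative (sin * cos ^+ n.+1 : R -> R) f)//.
  - by rewrite fctE /= !fctE /= cosN cos_pihalf !expr0n /= !mulr0 subrr.
  - by have := @pihalf_ge0 R; lra.
rewrite RintegralB//; [|exact: continuous_integrable..].
rewrite !RintegralZl//; [|exact: continuous_integrable (continuous_cosX _)..].
by move=> /eqP; rewrite subr_eq0 => /eqP.
Qed.

(** By [wallisS] the product [n.+1 * wallis n * wallis n.+1] does not depend
    on [n]. *)
Lemma wallis_mul (R : realType) (n : nat) :
  wallis R n * wallis R n.+1 = 2 * pi / n.+1%:R.
Proof.
elim: n => [|n IH]; first by rewrite wallis0 wallis1; field.
have n0 m : m.+1%:R != 0 :> R by rewrite pnatr_eq0.
apply: (mulfI (n0 n.+1)).
rewrite mulrCA wallisS mulrCA (mulrC (wallis R n.+1)) IH; field.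
by rewrite -(natrD _ 2 n) nat1r !n0.
Qed.

Lemma continuous_sqrtX {R : realType} (S : R) (q : nat) :
  continuous (fun y : R => Num.sqrt (S - y ^+ 2) ^+ q).
Proof.
move=> y.
apply: (cvg_comp (fun y : R => Num.sqrt (S - y ^+ 2)) (fun z => z ^+ q)).
  apply: (cvg_comp (fun y : R => S - y ^+ 2) Num.sqrt).
    by apply: cvgB; [exact: cvg_cst|exact: exprn_continuous].
  exact: sqrt_continuous.
exact: exprn_continuous.
Qed.

Lemma integral_chord {R : realType} (S : R) (q : nat) : 0 <= S ->
  \int[mu]_(y in `[- S, S]%classic) (Num.sqrt (S ^+ 2 - y ^+ 2) ^+ q) =
  wallis R q.+1 * S ^+ q.+1.
Proof.
rewrite le_eqVlt => /predU1P[<-|S0].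
  by rewrite oppr0 set_itv1 Rintegral_set1 expr0n /= mulr0.
pose F (t : R) : R := S * sin t.
have dF (t : R) : is_derive t (1 : R) F (S * cos t).
  exact: is_deriveZ.
have F'E : derive1 F = (fun t => S * cos t).
  by apply/funext => t; rewrite derive1E derive_val.
have cF' : continuous (fun t : R => S * cos t).
  by move=> t; apply: cvgM; [exact: cvg_cst|exact: continuous_cos].
have cF : continuous F.
  by move=> x; apply/differentiable_continuous/derivable1_diffP; apply: ex_derive.
have := @integration_by_substitution_increasing R F
  (fun y => Num.sqrt (S ^+ 2 - y ^+ 2) ^+ q) (- (pi / 2)) (pi / 2).
rewrite F'E.
have -> : F (- (pi / 2)) = - S by rewrite /F sinN sin_pihalf mulrN1.
have -> : F (pi / 2) = S by rewrite /F sin_pihalf mulr1.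
move=> sub; rewrite /Rintegral sub.
- transitivity (\int[mu]_(t in `[- (pi / 2), pi / 2]%classic)
                  (S ^+ q.+1 * cos t ^+ q.+1)); last first.
    rewrite RintegralZl//; last exact: continuous_integrable (continuous_cosX _).
    by rewrite mulrC.
  congr fine; apply: eq_integral => t; rewrite inE /= in_itv/= => tpi.
  rewrite fctE /= /F exprMn -[X in X - _]mulr1 -mulrBr -cos2sin2.
  rewrite -exprMn sqrtr_sqr ger0_norm; first by rewrite -exprMn exprSr.
  by rewrite mulr_ge0 ?(ltW S0)// cos_ge0_pihalf.
- by have := @pihalf_ge0 R; lra.
- move=> x y xpi ypi xy; rewrite /F ltr_pM2l//.
  by rewrite ltr_sin.
- by move=> x _; exact: cF'.
- by apply: cvgP; apply: cvg_at_right_filter; exact: cF'.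
- by apply: cvgP; apply: cvg_at_left_filter; exact: cF'.
- split; first by move=> x _; apply: ex_derive.
  + by apply: cvg_at_right_filter; exact: cF.
  + by apply: cvg_at_left_filter; exact: cF.
- exact/continuous_subspaceT/continuous_sqrtX.
Qed.

(** * Sums over translates of the integers *)

(** Divided by [p.+2], this is the weighted inequality of arithmetic and
    geometric means for [b ^+ p.+2] and [a ^+ p.+2] with weights [2] and [p].
    Induction on [p] keeps it polynomial: the difference at [p.+1] is [a]
    times the difference at [p] plus a product of two factors of equal sign. *)
Lemma weighted_AMGM {R : realDomainType} (p : nat) (a b : R) :
  0 <= a -> 0 <= b ->
  p.+2%:R * a ^+ p * b ^+ 2 <= 2 * b ^+ p.+2 + p%:R * a ^+ p.+2.
Proof.
move=> a0 b0; rewrite -subr_ge0; elim: p => [|p IH].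
  by rewrite expr0; lra.
have -> : 2 * b ^+ p.+3 + p.+1%:R * a ^+ p.+3 - p.+3%:R * a ^+ p.+1 * b ^+ 2 =
  a * (2 * b ^+ p.+2 + p%:R * a ^+ p.+2 - p.+2%:R * a ^+ p * b ^+ 2) +
  (b - a) * ((b ^+ p.+2 - a ^+ p.+2) + b * (b ^+ p.+1 - a ^+ p.+1)).
  by rewrite -!natr1 !exprS; ring.
apply: addr_ge0; first exact: mulr_ge0.
have [ab|/ltW ba] := leP a b.
  apply: mulr_ge0; first by rewrite subr_ge0.
  apply: addr_ge0; last apply: mulr_ge0 => //.
  - by rewrite subr_ge0 lerXn2r.
  - by rewrite subr_ge0 lerXn2r.
apply: mulr_le0; first by rewrite subr_le0.
rewrite -[leRHS]addr0 lerD//; last apply: mulr_ge0_le0 => //.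
- by rewrite subr_le0 lerXn2r.
- by rewrite subr_le0 lerXn2r.
Qed.

(** The function [u |-> u_+ ^ (p/2+1)] is convex, so it lies above its tangent
    at any [u >= 0].  As [Num.sqrt] vanishes on negative numbers, it encodes
    the positive part. *)
Lemma sqrtX_tangent {R : rcfType} (p : nat) (u v : R) : 0 <= u ->
  Num.sqrt u ^+ p.+2 + p.+2%:R / 2 * Num.sqrt u ^+ p * (v - u) <=
  Num.sqrt v ^+ p.+2.
Proof.
move=> u0; set a := Num.sqrt u.
have a0 : 0 <= a by exact: sqrtr_ge0.
have uE : u = a ^+ 2 by rewrite sqr_sqrtr.
have vb : v <= Num.sqrt v ^+ 2.
  by have [/ltW v0|/sqr_sqrtr->//] := ltP v 0; rewrite (le_trans v0)// sqr_ge0.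
have D0 : 0 <= p.+2%:R / 2 * a ^+ p by rewrite mulr_ge0 ?exprn_ge0// divr_ge0.
have := weighted_AMGM p a _ a0 (sqrtr_ge0 v).
move: (Num.sqrt v) vb => b vb.
have := ler_wpM2l D0 vb; rewrite uE mulrBr.
have -> : a ^+ p.+2 = a ^+ p * a ^+ 2 by rewrite -exprD addn2.
have -> : p.+2%:R = p%:R + 2 :> R by rewrite -addn2 natrD.
by move: (a ^+ p) (b ^+ 2) (b ^+ p.+2) (a ^+ 2) => A B C A2; nra.
Qed.

(** Jensen's inequality on a unit interval: the mean of [y ^+ 2] on it is
    [x ^+ 2 + 1 / 12], so the tangent of the convex function at [T - x ^+ 2]
    has mean value exactly the left-hand side. *)
Lemma cell_average {R : realType} (p : nat) (T x : R) :
  Num.sqrt (T - x ^+ 2) ^+ p.+2 <=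
  \int[mu]_(y in `[x - 1 / 2, x + 1 / 2]%classic)
     (Num.sqrt (T + 1 / 12 - y ^+ 2) ^+ p.+2).
Proof.
set u := T - x ^+ 2.
have [u0|u0] := ltP u 0.
  rewrite (ler0_sqrtr (ltW u0)) expr0n /=; apply: Rintegral_ge0 => y _.
  by rewrite exprn_ge0 ?sqrtr_ge0.
pose D := p.+2%:R / 2 * Num.sqrt u ^+ p.
pose l (y : R) := Num.sqrt u ^+ p.+2 + D * (T + 1 / 12 - y ^+ 2 - u).
pose c0 := Num.sqrt u ^+ p.+2 + D * (T + 1 / 12 - u).
have cl : continuous l.
  move=> y; apply: cvgD; first exact: cvg_cst.
  apply: cvgM; first exact: cvg_cst.
  by apply: cvgB; [apply: cvgB; [exact: cvg_cst|exact: exprn_continuous]|exact: cvg_cst].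
pose L (y : R) : R := c0 * y - D / 3 * y ^+ 3.
have dL (y : R) : is_derive y (1 : R) L (l y).
  have -> : L = c0 \*: (id : R -> R) - (D / 3) \*: ((id : R -> R) ^+ 3) by [].
  apply: is_derive_eq.
  by rewrite /l /c0 /GRing.scale /= !expr2 !mulr1; field.
rewrite (_ : _ ^+ p.+2 = \int[mu]_(y in `[x - 1 / 2, x + 1 / 2]%classic) l y).
  apply: le_Rintegral => //.
  - exact: continuous_integrable.
  - exact: continuous_integrable (continuous_sqrtX _ _).
  - by move=> y _; exact: sqrtX_tangent.
rewrite (Rintegral_antiderivative _ _ _ _ _ dL cl); last by lra.
by rewrite /L /c0 /u; field.
Qed.

(** The unit intervals centred at distinct points of a translate of [Z] are
    disjoint, so the bounds of [cell_average] add up to at most the integral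
    over the whole line. *)
Lemma sum_over_line {R : realType} (p : nat) (T c : R) (s : seq int) : uniq s ->
  \sum_(z <- s) Num.sqrt (T - (z%:~R + c) ^+ 2) ^+ p.+2 <=
  wallis R p.+3 * Num.sqrt (T + 1 / 12) ^+ p.+3.
Proof.
move=> us; have [T0|T0] := ltP (T + 1 / 12) 0.
  rewrite big1 => [|z _].
    by apply: mulr_ge0; [exact: wallis_ge0|rewrite exprn_ge0 ?sqrtr_ge0].
  rewrite ler0_sqrtr ?expr0n// subr_le0 (@le_trans _ _ 0) ?sqr_ge0//; lra.
pose g (y : R) : R := Num.sqrt (T + 1 / 12 - y ^+ 2) ^+ p.+2.
have g0 y : 0 <= g y by rewrite exprn_ge0 ?sqrtr_ge0.
have cg : continuous g by exact: continuous_sqrtX.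
have mg D : measurable_fun D g.
  by apply: measurable_funTS; exact: continuous_measurable_fun.
pose S : R := Num.sqrt (T + 1 / 12).
pose I (z : int) := `[z%:~R + c - 1 / 2, z%:~R + c + 1 / 2[%classic : set R.
have mI z : measurable (I z) by exact: measurable_itv.
(* the integrand vanishes outside the chord *)
have gS y : ~ `[- S, S]%classic y -> g y = 0.
  rewrite /= in_itv/= => /negP; rewrite -ler_norml -ltNge => Sy.
  rewrite /g ler0_sqrtr ?expr0n// subr_le0 -real_normK ?num_real//.
  by rewrite -(sqr_sqrtr T0) lerXn2r ?nnegrE ?sqrtr_ge0// ltW.
have tI : trivIset [set` s] I.
  move=> z z' _ _ [y]; rewrite /I /= !in_itv/= => -[/andP[a1 a2] /andP[b1 b2]].
  apply/eqP; rewrite eq_le -!ltzD1 -!(ltr_int R) !rmorphD /=.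
  by apply/andP; split; lra.
have cell (z : int) : ((Num.sqrt (T - (z%:~R + c) ^+ 2) ^+ p.+2)%:E <=
    \int[mu]_(y in I z) (g y)%:E)%E.
  rewrite /I integral_itv_bndo_bndc; last first.
    by apply/measurable_EFinP; exact: mg.
  rewrite -[leRHS]fineK ?lee_fin; first exact: cell_average.
  by apply: integrable_fin_num => //; exact: continuous_integrable.
rewrite -lee_fin -sumEFin.
apply: (le_trans (lee_sum _ (fun z _ => cell z))).
rewrite -ge0_integral_bigsetU//; last 2 first.
- by apply/measurable_EFinP; exact: mg.
- by move=> z _; rewrite lee_fin.
apply: (@le_trans _ _ (\int[mu]_y (g y)%:E)%E).
  apply: ge0_subset_integral => //.
  - by apply: bigsetU_measurable => z _; exact: mI.
  - by apply/measurable_EFinP; exact: mg.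
  - by move=> y _; rewrite lee_fin.
rewrite le_eqVlt; apply/orP; left; apply/eqP.
have -> : (\int[mu]_y (g y)%:E = \int[mu]_(y in `[- S, S]%classic%R) (g y)%:E)%E.
  rewrite [RHS]integral_mkcond; apply: eq_integral => y _; rewrite patchE.
  by case: ifPn => // /negP; rewrite inE => /gS ->.
rewrite -integral_chord ?sqrtr_ge0// (sqr_sqrtr T0) fineK//.
by apply: integrable_fin_num => //; exact: continuous_integrable.
Qed.

(** * Distinct lattice points *)

(** This product is the integral of [(1 - |y|^2)_+] over [R^k], computed by
    integrating out one coordinate at a time: slicing
    [(1 - |y|^2)_+ ^ (j/2+1)] along one coordinate contributes
    [wallis j.+3]. *)
Definition ball_kernel (R : realType) (k : nat) : R :=
  \prod_(j < k) wallis R j.+3.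

(** Induction on the dimension: the points with last coordinate [z] satisfy
    the bound in dimension [k] with [T] replaced by [T - (z + c k) ^+ 2], and
    [sum_over_line] sums these bounds over [z].  Points are indexed by a set
    [P] with coordinates in [nat -> int], so that passing to a lower dimension
    changes neither the indexing nor the coordinates. *)
Lemma sum_over_lattice {R : realType} {I : finType} (k : nat) :
  forall (P : {set I}) (x : I -> nat -> int) (c : nat -> R) (T : R),
  (forall i j, i \in P -> j \in P ->
     (forall l, (l < k)%N -> x i l = x j l) -> i = j) ->
  \sum_(i in P) Num.sqrt (T - \sum_(l < k) ((x i l)%:~R + c l) ^+ 2) ^+ 2 <=
  ball_kernel R k * Num.sqrt (T + k%:R / 12) ^+ k.+2.
Proof.
elim: k => [|k IH] P x c T inj.
  rewrite /ball_kernel big_ord0 mul1r mul0r addr0.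
  have [->|[i iP]] := set_0Vmem P; first by rewrite big_set0 exprn_ge0 ?sqrtr_ge0.
  have -> : P = [set i]%SET.
    by apply/setP => j; rewrite inE; apply/idP/eqP => [jP|->//]; exact: inj.
  by rewrite big_set1 big_ord0 subr0.
pose F i := Num.sqrt (T - \sum_(l < k.+1) ((x i l)%:~R + c l) ^+ 2) ^+ 2.
pose s := undup [seq x i k | i <- enum P].
have -> : \sum_(i in P) F i =
    \sum_(z <- s) \sum_(i in [set i in P | x i k == z]%SET) F i.
  under [RHS]eq_bigr do under eq_bigl do rewrite inE.
  rewrite (exchange_big_dep (mem P)) /=; last by move=> z i _ /andP[].
  apply: eq_bigr => i iP; rewrite iP /=.
  rewrite (eq_bigl (pred1 (x i k))); last by move=> z; rewrite eq_sym.
  rewrite -big_filter filter_pred1_uniq ?undup_uniq ?big_seq1//.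
  by rewrite mem_undup (map_f (fun j => x j k))// mem_enum.
(* the fibre over z is a family of distinct points of dimension k *)
have fiber z : \sum_(i in [set i in P | x i k == z]%SET) F i <=
    ball_kernel R k *
    Num.sqrt (T + k%:R / 12 - (z%:~R + c k) ^+ 2) ^+ k.+2.
  have := IH [set i in P | x i k == z]%SET x c (T - (z%:~R + c k) ^+ 2).
  rewrite addrAC => h; apply: le_trans (h _).
    rewrite le_eqVlt; apply/orP; left; apply/eqP; apply: eq_bigr => i.
    rewrite inE => /andP[_ /eqP xz]; rewrite /F big_ord_recr /= xz.
    by rewrite opprD addrA addrAC.
  move=> i j; rewrite !inE => /andP[iP /eqP xi] /andP[jP /eqP xj] xij.
  apply: inj => // l; rewrite ltnS leq_eqVlt => /predU1P[->|/xij//].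
  by rewrite xi xj.
apply: (le_trans (ler_sum _ (fun z _ => fiber z))).
rewrite -mulr_sumr /ball_kernel big_ord_recr /= -mulrA ler_wpM2l//.
  by apply: prodr_ge0 => l _; exact: wallis_ge0.
apply: le_trans (sum_over_line _ _ _ _ (undup_uniq _)) _.
by rewrite -addrA -mulrDl natr1.
Qed.

(** * Gaussian moments and the Gamma function at half-integers *)

Section GaussMoments.
Local Open Scope classical_set_scope.

Definition gauss_moment {R : realType} (q : nat) (b : R) : R :=
  \int[mu]_(u in `[0, b]) (u ^+ q * expR (- u ^+ 2)).

Lemma continuous_gauss_moment {R : realType} (q : nat) :
  continuous (fun u : R => u ^+ q * expR (- u ^+ 2)).
Proof.
by move=> u; apply: cvgM; [exact: exprn_continuous|exact: continuous_gauss_fun].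
Qed.

Lemma is_derive_gauss {R : realType} (u : R) :
  is_derive u (1 : R) (@gauss_fun R) (- 2 * u * expR (- u ^+ 2)).
Proof.
have d : is_derive u (1 : R) (- (id : R -> R) ^+ 2) (- 2 * u).
  by apply: is_derive_eq; rewrite /GRing.scale /= expr1; ring.
have := is_derive1_comp (is_derive_expR ((- (id : R -> R) ^+ 2) u)) d.
by move=> h; apply: (is_derive_eq h); rewrite mulrC.
Qed.

(** Integration by parts, read off the derivative of
    [u ^+ q.+1 * expR (- u ^+ 2)]. *)
Lemma gauss_moment_step {R : realType} (q : nat) (b : R) : 0 <= b ->
  2 * gauss_moment q.+2 b = q.+1%:R * gauss_moment q b - b ^+ q.+1 * expR (- b ^+ 2).
Proof.
move=> b0.
pose f (u : R) := q.+1%:R * (u ^+ q * expR (- u ^+ 2)) -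
  2 * (u ^+ q.+2 * expR (- u ^+ 2)).
have c1 : continuous (fun u : R => q.+1%:R * (u ^+ q * expR (- u ^+ 2))).
  by move=> u; apply: cvgM; [exact: cvg_cst|exact: continuous_gauss_moment].
have c2 : continuous (fun u : R => 2 * (u ^+ q.+2 * expR (- u ^+ 2))).
  by move=> u; apply: cvgM; [exact: cvg_cst|exact: continuous_gauss_moment].
have cf : continuous f by move=> u; apply: cvgB; [exact: c1|exact: c2].
pose F (u : R) : R := u ^+ q.+1 * expR (- u ^+ 2).
have dF (u : R) : is_derive u (1 : R) F (f u).
  have -> : F = ((id : R -> R) ^+ q.+1 : R -> R) * @gauss_fun R.
    by apply/funext => v; rewrite fctE /= fctE.
  apply: (is_derive_eq (is_deriveM (is_deriveX q.+1 (is_derive_id u (1 : R)))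
                                   (is_derive_gauss u))).
  rewrite /f /GRing.scale /= fctE /= /gauss_fun; move: (expR _) => e.
  by rewrite !exprS; ring.
have := Rintegral_antiderivative F f 0 b b0 dF cf.
rewrite /F expr0n /= mul0r subr0.
rewrite RintegralB//; [|exact: continuous_integrable..].
rewrite !RintegralZl//; [|exact: continuous_integrable (continuous_gauss_moment _)..].
by rewrite /gauss_moment => <-; ring.
Qed.

Lemma cvg_gauss_tail {R : realType} (q : nat) :
  (n%:R ^+ q.+1 * expR (- n%:R ^+ 2) : R) @[n --> \oo] --> (0 : R).
Proof.
have h : ((q.+1)`!%:R * (@harmonic R n)) @[n --> \oo] --> (0 : R).
  rewrite -[X in _ --> X](mulr0 (q.+1)`!%:R).
  by apply: cvgM; [exact: cvg_cst|exact: cvg_harmonic].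
rewrite -cvg_shiftS; apply: (squeeze_cvgr _ (cvg_cst 0) h).
apply: nearW => n; rewrite /= mulr_ge0 ?exprn_ge0 ?expR_ge0//=.
have n0 : 0 < n.+1%:R :> R by rewrite ltr0n.
have f0 : 0 < (q.+1)`!%:R :> R by rewrite ltr0n fact_gt0.
have := @expR_ge1Dxn R (n.+1%:R ^+ 2) q (exprn_ge0 _ (ltW n0)).
rewrite expRN /harmonic ler_pdivrMr ?expR_gt0// => h1.
have h2 : n.+1%:R * (n.+1%:R ^+ q.+1) <= (n.+1%:R ^+ 2) ^+ q.+1 :> R.
  rewrite -exprS -exprM ler_weXn2l ?ler1n//.
  by rewrite mul2n doubleS !ltnS -addnn leq_addr.
have h3 : (n.+1%:R ^+ 2) ^+ q.+1 <= (q.+1)`!%:R * expR (n.+1%:R ^+ 2) :> R.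
  by rewrite mulrC -ler_pdivrMr//; lra.
rewrite mulrAC ler_pdivlMr// mulrC; exact: le_trans h3.
Qed.

Lemma cvg_gauss_moment_step {R : realType} (q : nat) (l : R) :
  gauss_moment q n%:R @[n --> \oo] --> l ->
  gauss_moment q.+2 n%:R @[n --> \oo] --> q.+1%:R / 2 * l.
Proof.
move=> hl.
have -> : (fun n => gauss_moment q.+2 (n%:R : R)) = (fun n =>
    q.+1%:R / 2 * gauss_moment q n%:R - 1 / 2 * (n%:R ^+ q.+1 * expR (- n%:R ^+ 2))).
  apply/funext => n; have := @gauss_moment_step R q n%:R (ler0n _ _); lra.
rewrite -[X in _ --> X]subr0; apply: cvgB.
  by apply: cvgM => //; exact: cvg_cst.
rewrite -[X in _ --> X](mulr0 (1 / 2)).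
by apply: cvgM; [exact: cvg_cst|exact: cvg_gauss_tail].
Qed.

Lemma cvg_gauss_moment0 {R : realType} :
  gauss_moment 0 n%:R @[n --> \oo] --> (Num.sqrt pi / 2 : R).
Proof.
have := @ge0_cvgn_integral R mu _ gauss_fun_ge0 measurable_gauss_fun.
rewrite integral0y_gauss => /fine_cvg /=.
suff -> : (fun n => gauss_moment 0 (n%:R : R)) =
  (fine \o (fun n : nat => (\int[mu]_(x in `[0%R, n%:R]) (gauss_fun x)%:E)%E)) by [].
apply/funext => n /=; rewrite /gauss_moment /Rintegral; congr fine.
by apply: eq_integral => u _; rewrite expr0 mul1r.
Qed.

Lemma cvg_gauss_moment1 {R : realType} :
  gauss_moment 1 n%:R @[n --> \oo] --> (1 / 2 : R).
Proof.
have E (n : nat) : gauss_moment 1 (n%:R : R) = 1 / 2 - 1 / 2 * expR (- n%:R ^+ 2).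
  pose f (u : R) := u ^+ 1 * expR (- u ^+ 2).
  have dF (u : R) : is_derive u (1 : R) ((- (1 / 2)) \*: (@gauss_fun R)) (f u).
    apply: (is_derive_eq (is_deriveZ _ (is_derive_gauss u))).
    by rewrite /f /GRing.scale /=; field.
  rewrite /gauss_moment (Rintegral_antiderivative _ f 0 _ (ler0n _ _) dF).
    by rewrite /= /gauss_fun /GRing.scale /= expr0n /= oppr0 expR0; ring.
  exact: continuous_gauss_moment.
rewrite (funext E) -[X in _ --> X]subr0; apply: cvgB; first exact: cvg_cst.
rewrite -[X in _ --> X](mulr0 (1 / 2)); apply: cvgM; first exact: cvg_cst.
exact: (cvg_comp _ _ cvgr_idn cvg_gauss_fun).
Qed.

Lemma ball_kernelSS (R : realType) (k : nat) :
  ball_kernel R k.+2 = ball_kernel R k * (2 * pi / k.+4%:R).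
Proof. by rewrite /ball_kernel !big_ord_recr /= -mulrA wallis_mul. Qed.

Lemma ball_kernel_gt0 (R : realType) (k : nat) : 0 < ball_kernel R k.
Proof.
apply: prodr_gt0 => j _; rewrite lt_def wallis_ge0 andbT.
apply/eqP => w0; have := wallis_mul R j.+3; rewrite w0 mul0r => /eqP.
by rewrite eq_sym mulf_eq0 mulf_eq0 invr_eq0 !pnatr_eq0 /= gt_eqF ?pi_gt0.
Qed.

(** With these limits the recursion of Gaussian moments matches
    [ball_kernelSS]; it has step two, hence the induction on pairs of
    consecutive indices, started by the integrals of the Gaussian and of its
    product with [u]. *)
Lemma cvg_gauss_moment {R : realType} (k : nat) :
  gauss_moment k.+1 n%:R @[n --> \oo] -->
  (Num.sqrt pi ^+ k / (k.+2%:R * ball_kernel R k) : R).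
Proof.
have [] : (gauss_moment k.+1 n%:R @[n --> \oo] -->
    (Num.sqrt pi ^+ k / (k.+2%:R * ball_kernel R k) : R)) /\
  (gauss_moment k.+2 n%:R @[n --> \oo] -->
    (Num.sqrt pi ^+ k.+1 / (k.+3%:R * ball_kernel R k.+1) : R)) => //.
elim: k => [|k [IH1 IH2]]; split => //.
- rewrite /ball_kernel big_ord0 expr0 mulr1; exact: cvg_gauss_moment1.
- have -> : Num.sqrt pi ^+ 1 / (3%:R * ball_kernel R 1) =
      1%:R / 2 * (Num.sqrt pi / 2) :> R.
    have := wallisS R 1; rewrite wallis1 /ball_kernel big_ord1 => w3.
    have -> : wallis R 3 = 4 / 3 by lra.
    by field.
  exact: cvg_gauss_moment_step cvg_gauss_moment0.
- have -> : Num.sqrt pi ^+ k.+2 / (k.+4%:R * ball_kernel R k.+2) =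
      k.+2%:R / 2 * (Num.sqrt pi ^+ k / (k.+2%:R * ball_kernel R k)) :> R.
    rewrite ball_kernelSS !exprS (mulrA (Num.sqrt pi)) -expr2 sqr_sqrtr ?pi_ge0//.
    have := lt0r_neq0 (@pi_gt0 R); have := lt0r_neq0 (ball_kernel_gt0 R k).
    move: (ball_kernel R k) (Num.sqrt pi ^+ k) => B S B0.
    move: pi => p p0; field.
    by rewrite B0 p0 -!natrD !pnatr_eq0.
  exact: cvg_gauss_moment_step IH1.
Qed.

(** The volume of the unit ball in disguise: [ball_kernel k * (k/2+1)] is
    the integral of [(1 - |y|^2)_+] times [(k+2)/2], which is the volume
    [pi^(k/2) / Gamma(k/2+1)].  The substitution [t = u ^+ 2] turns
    [Gamma (k/2+1)] into twice the Gaussian moment of order [k.+1]. *)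
Lemma Gamma_half {R : realType} (k : nat) :
  ball_kernel R k * ((k%:R / 2 + 1) * Gamma (k%:R / 2 + 1)) = Num.sqrt pi ^+ k.
Proof.
pose g (t : R) : R := Num.sqrt t ^+ k * expR (- t).
have g0 t : 0 <= g t by rewrite mulr_ge0 ?exprn_ge0 ?sqrtr_ge0 ?expR_ge0.
have cg : continuous g.
  move=> t; apply: cvgM.
    apply: (cvg_comp Num.sqrt (fun z => z ^+ k)).
      exact: sqrt_continuous.
    exact: exprn_continuous.
  apply: (cvg_comp -%R expR); last exact: continuous_expR.
  exact: cvgN.
have mg : measurable_fun setT g by exact: continuous_measurable_fun.
have sub (n : nat) : (\int[mu]_(t in `[0%R, (n ^ 2)%:R]) (g t)%:E)%E =
    (2 * gauss_moment k.+1 n%:R)%:E.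
  pose F (u : R) : R := u ^+ 2.
  have F'E : derive1 F = (fun u => 2 * u).
    by apply/funext => u; rewrite derive1E exp_derive /GRing.scale /= expr1 mulr1.
  have cF : continuous F by exact: exprn_continuous.
  have cF' : continuous (fun u : R => 2 * u).
    by move=> u; apply: cvgM; [exact: cvg_cst|exact: cvg_id].
  have := @integration_by_substitution_increasing R F g 0 n%:R (ler0n _ _).
  have -> : F 0 = 0 by rewrite /F expr0n.
  have -> : F n%:R = (n ^ 2)%:R by rewrite /F natrX.
  rewrite F'E => ->.
  - rewrite /gauss_moment -RintegralZl//; last first.
      exact: continuous_integrable (continuous_gauss_moment _).
    rewrite /Rintegral fineK; last first.
      apply: integrable_fin_num => //; apply: continuous_integrable => u.
      apply: cvgM; first exact: cvg_cst.
      exact: continuous_gauss_moment.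
    apply: eq_integral => u; rewrite inE /= in_itv /= => /andP[u0 _].
    congr EFin; rewrite fctE /= /g /F sqrtr_sqr ger0_norm//.
    by move: (expR _) => e; rewrite exprS; ring.
  - move=> x y; rewrite !in_itv /= => /andP[x0 _] /andP[y0 _] xy.
    by rewrite /F ltrXn2r.
  - by move=> x _; exact: cF'.
  - by apply: cvgP; apply: cvg_at_right_filter; exact: cF'.
  - by apply: cvgP; apply: cvg_at_left_filter; exact: cF'.
  - split; first by move=> x _; exact: exprn_derivable.
    + by apply: cvg_at_right_filter; exact: cF.
    + by apply: cvg_at_left_filter; exact: cF.
  - exact/continuous_subspaceT.
(* along the squares, both sides of the substitution have integer bounds *)
have cvg_sqrn : (n ^ 2)%N @[n --> \oo] --> \oo.
  apply/cvgnyPge => A; near=> n.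
  apply: (@leq_trans n); first by near: n; exact: nbhs_infty_ge.
  by rewrite -mulnn leq_pmulr//; near: n; exact: nbhs_infty_gt.
have limg := cvg_comp _ _ cvg_sqrn (@ge0_cvgn_integral R mu g g0 mg).
have lim2 : (\int[mu]_(t in `[0%R, (n ^ 2)%:R]) (g t)%:E)%E @[n --> \oo] -->
    (2 * (Num.sqrt pi ^+ k / (k.+2%:R * ball_kernel R k)))%:E.
  rewrite (funext sub); apply: cvg_EFin; first exact: nearW.
  by apply: cvgM; [exact: cvg_cst|exact: cvg_gauss_moment].
have intg := cvg_unique (@ereal_hausdorff R) limg lim2 : _ = _.
have -> : Gamma (k%:R / 2 + 1) = fine (\int[mu]_(t in `[0%R, +oo[) (g t)%:E)%E.
  rewrite -integral_itv_obnd_cbnd; last first.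
    by apply/measurable_EFinP; apply: measurable_funTS.
  congr fine; apply: eq_integral => t; rewrite inE /= in_itv /= andbT => t0.
  congr EFin; rewrite /g addrK -powR12_sqrt ?(ltW t0)// -powR_mulrn ?powR_ge0//.
  by rewrite -powRrM (mulrC (2^-1)).
rewrite intg /=; have := lt0r_neq0 (ball_kernel_gt0 R k).
move: (ball_kernel R k) (Num.sqrt pi ^+ k) => B S B0; field.
by rewrite B0 -natrD pnatr_eq0.
Unshelve. all: by end_near. Qed.

End GaussMoments.

(** * Variance of subset sums *)

Lemma card_sets (R : realFieldType) (T : finType) :
  #|[set: {set T}]%SET|%:R = 2 ^+ #|T| :> R.
Proof. by rewrite -finset.powersetT card_powerset cardsT natrX. Qed.

Lemma sum_sets_const {R : realFieldType} {T : finType} (x : R) :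
  \sum_(A : {set T}) x = 2 ^+ #|T| * x.
Proof.
rewrite -card_sets mulr_natl -sumr_const.
by apply: eq_bigl => A; rewrite inE.
Qed.

Section signs.
Variables (R : realFieldType) (T : finType).
Implicit Types (A : {set T}) (i j : T) (b : T -> R).

Let sgn A i : R := if i \in A then 1 else -1.
Let flip i A : {set T} := if i \in A then A :\ i else i |: A.

Let flipE i A j : (j \in flip i A) = (j == i) (+) (j \in A).
Proof.
by rewrite /flip; case: ifP => iA; rewrite !inE; case: eqVneq => [->|]; rewrite ?iA.
Qed.

Let flipK i : involutive (flip i).
Proof. by move=> A; apply/setP => j; rewrite !flipE addbA addbb. Qed.

Let sum_sgn i j : \sum_A sgn A i * sgn A j = if i == j then 2 ^+ #|T| else 0.
Proof.
case: eqVneq => [->|ij].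
  rewrite (eq_bigr (fun=> 1)); last first.
    by move=> A _; rewrite /sgn; case: ifP; rewrite ?mulrNN mulr1.
  by rewrite sum_sets_const mulr1.
have antisym : \sum_A sgn A i * sgn A j = - \sum_A sgn A i * sgn A j.
  rewrite {1}(reindex_inj (can_inj (flipK i))) /= -sumrN; apply: eq_bigr => A _.
  rewrite /sgn !flipE eqxx eq_sym (negPf ij) /=.
  by case: (i \in A) => /=; ring.
by move: (\sum_A _) antisym => X; lra.
Qed.

Lemma centered_sumE A b :
  \sum_(i in A) b i - (\sum_i b i) / 2 =
  \sum_i (if i \in A then 1 else -1) * (b i / 2).
Proof.
rewrite big_mkcond mulr_suml -sumrB; apply: eq_bigr => i _.
by case: ifP => _; field.
Qed.

(** The variance of a sum of independent random signs: in the expanded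
    square the off-diagonal terms cancel, since toggling the membership of one
    index [i] in [A] changes the sign of exactly one of two factors. *)
Lemma sum_centered_sqr b :
  \sum_(A : {set T}) (\sum_(i in A) b i - (\sum_i b i) / 2) ^+ 2 =
  2 ^+ #|T| / 4 * \sum_i b i ^+ 2.
Proof.
transitivity (\sum_A \sum_i \sum_j (sgn A i * sgn A j) * (b i / 2 * (b j / 2))).
  apply: eq_bigr => A _; rewrite centered_sumE expr2 mulr_suml.
  by apply: eq_bigr => i _; rewrite mulr_sumr; apply: eq_bigr => j _; rewrite mulrACA.
rewrite exchange_big mulr_sumr; apply: eq_bigr => i _ /=.
rewrite exchange_big (bigD1 i)//= [X in _ + X]big1 ?addr0.
  by rewrite -mulr_suml sum_sgn eqxx; field.
by move=> j ij; rewrite -mulr_suml sum_sgn eq_sym (negPf ij) mul0r.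
Qed.

End signs.

Lemma centered_sumC {R : realFieldType} {T : finType} (A : {set T}) (b : T -> R) :
  \sum_(i in ~: A) b i - (\sum_i b i) / 2 =
  - (\sum_(i in A) b i - (\sum_i b i) / 2).
Proof.
rewrite !centered_sumE -sumrN; apply: eq_bigr => i _.
by rewrite inE; case: (i \in A) => /=; ring.
Qed.

(** Functions invariant under complementation have the same average over [G]
    as over all subsets. *)
Definition complement_balanced (R : realFieldType) (T : finType) (G : {set {set T}}) :=
  forall f : {set T} -> R, (forall A, f (~: A) = f A) ->
  2 ^+ #|T| * \sum_(A in G) f A = #|G|%:R * \sum_A f A.

Lemma balanced_all (R : realFieldType) (T : finType) :
  complement_balanced R T [set: {set T}]%SET.
Proof.
move=> f _; rewrite card_sets; congr (_ * _).
by apply: eq_bigl => A; rewrite inE.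
Qed.

(** Exactly one set from each complementary pair, the smaller one; when both
    have the same size, membership of [i0] decides. *)
Definition half_family (T : finType) (i0 : T) : {set {set T}} :=
  [set A : {set T} | (#|A|.*2 < #|T|)%N || (#|A|.*2 == #|T|) && (i0 \in A)].

Lemma half_familyC (T : finType) (i0 : T) (A : {set T}) :
  (~: A \in half_family T i0) = (A \notin half_family T i0).
Proof.
rewrite !inE -(cardsC A) -!addnn ltn_add2r ltn_add2l eqn_add2r eqn_add2l.
by rewrite (eq_sym #|~: A|); case: ltngtP; case: (i0 \in A).
Qed.

Lemma sum_half_family (R : realFieldType) (T : finType) (i0 : T) (f : {set T} -> R) :
  (forall A, f (~: A) = f A) ->
  2 * \sum_(A in half_family T i0) f A = \sum_A f A.
Proof.
move=> fC; rewrite [RHS](bigID (mem (half_family T i0))) /= mulr_natl mulr2n.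
congr (_ + _); rewrite (reindex_inj (inv_inj (@finset.setCK T))) /=.
by apply: eq_big => A; rewrite ?half_familyC ?fC.
Qed.

Lemma card_half_family (R : realFieldType) (T : finType) (i0 : T) :
  2 * #|half_family T i0|%:R = 2 ^+ #|T| :> R.
Proof.
by rewrite -sumr_const sum_half_family// sum_sets_const mulr1.
Qed.

Lemma balanced_half (R : realFieldType) (T : finType) (i0 : T) :
  complement_balanced R T (half_family T i0).
Proof.
move=> f fC; rewrite -(sum_half_family R T i0 f fC).
by rewrite -(card_half_family R T i0); ring.
Qed.

(** * Sum-distinct sequences *)

Section distinct_sums.
Context {R : realType} {k n : nat}.
Variables (a : 'I_n -> 'rV[int]_k.+1) (M : R) (G : {set {set 'I_n}}).

Let coord (l : nat) (i : 'I_n) : R := (a i 0 (inord l))%:~R.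
Let deviation (A : {set 'I_n}) : R :=
  \sum_(l < k.+1) (\sum_(i in A) coord l i - (\sum_i coord l i) / 2) ^+ 2.

Lemma sum_deviation_le : bounded_seq M a ->
  \sum_A deviation A <= 2 ^+ n / 4 * (k.+1%:R * n%:R * M ^+ 2).
Proof.
move=> aM; rewrite exchange_big /=.
under eq_bigr do rewrite sum_centered_sqr.
rewrite -mulr_sumr card_ord ler_wpM2l ?mulr_ge0 ?exprn_ge0 ?invr_ge0//.
have sqr_le l i : coord l i ^+ 2 <= M ^+ 2.
  by have /andP[c0 cM] := aM i (inord l); rewrite lerXn2r ?nnegrE ?(le_trans c0 cM).
apply: (@le_trans _ _ (\sum_(l < k.+1) \sum_(i < n) M ^+ 2)).
  by apply: ler_sum => l _; apply: ler_sum => i _; exact: sqr_le.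
by rewrite !sumr_const !card_ord -mulrnA -[leLHS]mulr_natl natrM (mulrC n%:R).
Qed.

(** Each term of [sum_over_lattice] at [T = r ^+ 2 - k / 12] is at least
    [T] minus the squared distance from the centre. *)
Lemma lattice_second_moment (r : R) : 0 <= r ->
  sum_distinct G a ->
  #|G|%:R * (r ^+ 2 - k.+1%:R / 12) - ball_kernel R k.+1 * r ^+ k.+3 <=
  \sum_(A in G) deviation A.
Proof.
move=> r0 da.
pose x (A : {set 'I_n}) (l : nat) : int := subset_sum a A 0 (inord l).
pose c (l : nat) : R := - ((\sum_i coord l i) / 2).
have devE A : deviation A = \sum_(l < k.+1) ((x A l)%:~R + c l) ^+ 2.
  apply: eq_bigr => l _; congr ((_ + _) ^+ 2).
  rewrite /x /subset_sum summxE rmorph_sum; exact: eq_bigr.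
have := @sum_over_lattice R _ k.+1 G x c (r ^+ 2 - k.+1%:R / 12).
rewrite subrK sqrtr_sqr ger0_norm// => lat.
rewrite lerBlDr -lerBlDl mulr_natl -sumr_const -sumrB.
apply: le_trans (lat _); last first.
  move=> A B AG BG xAB; apply: contrapT => /(da _ _ AG BG); apply.
  by apply/rowP => j; have := xAB j (ltn_ord j); rewrite /x !inord_val.
apply: ler_sum => A _; rewrite -devE.
have [v0|/sqr_sqrtr->//] := ltP (r ^+ 2 - k.+1%:R / 12 - deviation A) 0.
by rewrite (le_trans (ltW v0))// sqr_ge0.
Qed.

Lemma sum_distinct_moment_bound (r : R) : 0 <= r ->
  complement_balanced R 'I_n G -> sum_distinct G a -> bounded_seq M a ->
  #|G|%:R * (r ^+ 2 - k.+1%:R / 12) - ball_kernel R k.+1 * r ^+ k.+3 <=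
  #|G|%:R / 4 * (k.+1%:R * n%:R * M ^+ 2).
Proof.
move=> r0 bal da aM; apply: le_trans (lattice_second_moment r r0 da) _.
have p2 : 0 < 2 ^+ n :> R by rewrite exprn_gt0.
rewrite -(ler_pM2l p2).
have -> : 2 ^+ n * \sum_(A in G) deviation A = #|G|%:R * \sum_A deviation A.
  rewrite -{1}(card_ord n) bal// => A; apply: eq_bigr => l _.
  by rewrite centered_sumC sqrrN.
apply: le_trans (ler_wpM2l (ler0n _ _) (sum_deviation_le aM)) _.
by rewrite le_eqVlt; apply/orP; left; apply/eqP; ring.
Qed.

End distinct_sums.

Lemma Gamma_half_gt0 {R : realType} (k : nat) : 0 < Gamma (k%:R / 2 + 1) :> R.
Proof.
have := Gamma_half k; set g := Gamma _ => gE.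
have : 0 < ball_kernel R k * ((k%:R / 2 + 1) * g).
  by rewrite gE exprn_gt0// sqrtr_gt0 pi_gt0.
rewrite pmulr_rgt0 ?ball_kernel_gt0// pmulr_rgt0//.
Qed.

(** The hypothesis on [r] says that the ball of radius [r] has volume [#|G|];
    this choice of [r] optimizes [sum_distinct_moment_bound]. *)
Lemma sum_distinct_sqr_bound {R : realType} {k n : nat} (a : 'I_n -> 'rV[int]_k.+1)
    (M : R) (G : {set {set 'I_n}}) (r : R) :
  (0 < n)%N -> (0 < #|G|)%N -> 0 <= r ->
  ball_kernel R k.+1 * r ^+ k.+1 = 2 / k.+3%:R * #|G|%:R ->
  complement_balanced R 'I_n G -> sum_distinct G a -> bounded_seq M a ->
  4 / (n%:R * k.+3%:R) * r ^+ 2 - 1 / (3 * n%:R) <= M ^+ 2.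
Proof.
move=> n0 m0 r0 vol bal da aM.
have := sum_distinct_moment_bound a M G r r0 bal da aM.
have -> : r ^+ k.+3 = r ^+ k.+1 * r ^+ 2 by rewrite -exprD addn2.
rewrite mulrA vol.
have -> : k.+3%:R = k.+1%:R + 2 :> R by rewrite -addn2 natrD.
have : 0 < #|G|%:R :> R by rewrite ltr0n.
have : 0 < n%:R :> R by rewrite ltr0n.
have : 0 < k.+1%:R :> R by rewrite ltr0n.
move: (n%:R) (#|G|%:R) (k.+1%:R) (r ^+ 2) (M ^+ 2) => nn m K r2 M2 K0 nn0 m0' h.
have {}h : r2 - K / 12 - 2 / (K + 2) * r2 <= (K * nn * M2) / 4.
  by rewrite -(ler_pM2l m0'); lra.
have Knn : 0 < K * nn / 4 by rewrite divr_gt0 ?mulr_gt0.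
rewrite -(ler_pM2l Knn).
have -> : K * nn / 4 * (4 / (nn * (K + 2)) * r2 - 1 / (3 * nn)) =
   r2 - K / 12 - 2 / (K + 2) * r2.
  by field; rewrite !gt_eqF ?addr_gt0.
lra.
Qed.

Lemma root_expn {R : realType} (k : nat) (x : R) : 0 <= x ->
  (x `^ (1 / k.+1%:R)) ^+ k.+1 = x.
Proof.
move=> x0; rewrite -powR_mulrn ?powR_ge0// -powRrM mul1r mulVf ?powRr1//.
Qed.

(** The number of lattice points beyond which the ball with that volume has
    radius at least the square root of [(k+2) / (12 eps)]; from there on the
    additive error [1 / (3 n)] is absorbed by a fraction [eps] of the main
    term. *)
Definition size_threshold {R : realType} (k : nat) (eps : R) : R :=
  Num.sqrt pi ^+ k / Gamma (k%:R / 2 + 1) * Num.sqrt (k.+2%:R / (12 * eps)) ^+ k.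

Lemma sum_distinct_bound {R : realType} {k n : nat} (a : 'I_n -> 'rV[int]_k.+1)
    (M : R) (G : {set {set 'I_n}}) (eps : R) :
  0 < eps -> (0 < n)%N -> (0 < #|G|)%N -> size_threshold k.+1 eps <= #|G|%:R ->
  complement_balanced R 'I_n G -> sum_distinct G a -> bounded_seq M a ->
  (1 - eps) * (Num.sqrt (4 / (pi * n%:R * (k.+1%:R + 2))) *
    Gamma (k.+1%:R / 2 + 1) `^ (1 / k.+1%:R) * #|G|%:R `^ (1 / k.+1%:R)) <= M.
Proof.
move=> eps0 n0 m0 big bal da aM.
set mt := Num.sqrt _ * _ * _.
have mt0 : 0 <= mt by rewrite /mt !mulr_ge0 ?sqrtr_ge0 ?powR_ge0.
have M0 : 0 <= M by have /andP[] := aM (Ordinal n0) ord0; exact: le_trans.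
(* squaring below requires 1 - eps to be positive *)
have [e1|e1] := leP 1 eps.
  by apply: le_trans M0; rewrite mulr_le0_ge0// subr_le0.
have G0 := @Gamma_half_gt0 R k.+1; set g := Gamma _ in G0 mt mt0 *.
have sp0 : 0 < Num.sqrt pi :> R by rewrite sqrtr_gt0 pi_gt0.
have n0' : 0 < n%:R :> R by rewrite ltr0n.
pose r : R := g `^ (1 / k.+1%:R) * #|G|%:R `^ (1 / k.+1%:R) / Num.sqrt pi.
have r0 : 0 <= r by rewrite /r !mulr_ge0 ?powR_ge0 ?invr_ge0 ?sqrtr_ge0.
have rk : r ^+ k.+1 = g * #|G|%:R / Num.sqrt pi ^+ k.+1.
  by rewrite /r expr_div_n exprMn !root_expn ?(ltW G0).
have mt2 : mt ^+ 2 = 4 / (n%:R * k.+3%:R) * r ^+ 2.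
  rewrite /mt /r -mulrA exprMn expr_div_n sqr_sqrtr; last first.
    by rewrite divr_ge0 ?mulr_ge0 ?pi_ge0 ?addr_ge0.
  rewrite sqr_sqrtr ?pi_ge0// -[k.+3]addn2 natrD.
  have := lt0r_neq0 (@pi_gt0 R); move: pi (g `^ _ * _) => p y p0.
  by field; rewrite p0 (lt0r_neq0 n0') nat1r -natrD pnatr_eq0.
have vol : ball_kernel R k.+1 * r ^+ k.+1 = 2 / k.+3%:R * #|G|%:R.
  have := Gamma_half k.+1 (R := R); rewrite -/g rk => <-.
  have g0' := lt0r_neq0 G0; have := lt0r_neq0 (ball_kernel_gt0 R k.+1).
  rewrite -[k.+3]addn2 natrD.
  move: (ball_kernel R k.+1) => B B0; field.
  by rewrite B0 g0' nat1r -natrD pnatr_eq0.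
have := sum_distinct_sqr_bound a M G r n0 m0 r0 vol bal da aM.
rewrite -mt2 => low.
have rbig : k.+3%:R / (12 * eps) <= r ^+ 2.
  rewrite -(@sqr_sqrtr _ (k.+3%:R / (12 * eps))); last first.
    by rewrite divr_ge0 ?mulr_ge0 ?(ltW eps0).
  rewrite lerXn2r ?nnegrE ?sqrtr_ge0// -(@ler_pXn2r _ k.+1) ?nnegrE ?sqrtr_ge0//.
  rewrite rk ler_pdivlMr ?exprn_gt0// mulrC -ler_pdivrMl//.
  by apply: le_trans big; rewrite /size_threshold -/g mulrA (mulrC g^-1).
have err : 1 / (3 * n%:R) <= eps * mt ^+ 2.
  rewrite mt2.
  have -> : 1 / (3 * n%:R) = eps * (4 / (n%:R * k.+3%:R) * (k.+3%:R / (12 * eps))).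
    have : k.+3%:R != 0 :> R by rewrite pnatr_eq0.
    have := lt0r_neq0 eps0; have := lt0r_neq0 n0'.
    by move: (k.+3%:R) (n%:R) => K N N0 e0 K0; field; rewrite N0 e0 K0.
  by rewrite !ler_wpM2l ?(ltW eps0)// divr_ge0.
rewrite -(@ler_pXn2r _ 2) ?nnegrE//; last by rewrite mulr_ge0// subr_ge0 ltW.
(* here (1 - eps) ^+ 2 <= 1 - eps is what leaves room for the error *)
rewrite exprMn; apply: (@le_trans _ _ ((1 - eps) * mt ^+ 2)).
  by rewrite ler_wpM2r ?sqr_ge0// expr2 ler_piMr ?subr_ge0 ?(ltW e1)// gerBl ltW.
by rewrite mulrBl mul1r; lra.
Qed.

Theorem theorem2p5 (R : realType) (k : nat) (lam : R)
    (hk : (1 <= k)%N) (hlam : 1 / 2 <= lam <= 1) :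
  forall eps : R, 0 < eps ->
  exists N : nat, forall n : nat, (N <= n)%N ->
  forall (a : 'I_n -> 'rV[int]_k) (M : R),
    sum_distinct (small_subsets lam n) a ->
    bounded_seq M a ->
    (1 - eps) * main_term k lam n <= M.
Proof.
case: k hk => // k _ eps eps0.
pose N0 := Num.bound (size_threshold k.+1 eps).
have N0P : size_threshold k.+1 eps <= N0%:R.
  apply/ltW/archi_boundP; rewrite /size_threshold !mulr_ge0 ?exprn_ge0 ?sqrtr_ge0//.
  by rewrite invr_ge0 ltW// Gamma_half_gt0.
exists N0.+1 => -[//|n]; rewrite ltnS => Nn a M da aM.
have powle : size_threshold k.+1 eps <= 2 ^+ n.
  apply: (le_trans N0P); rewrite -natrX ler_nat (leq_trans Nn)//.
  exact/ltnW/ltn_expl.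
rewrite /main_term; case: eqVneq => [lam1|lam1].
- pose G : {set {set 'I_n.+1}} := [set: {set 'I_n.+1}]%SET.
  have cG : #|G|%:R = 2 ^+ n.+1 :> R by rewrite /G card_sets card_ord.
  rewrite (_ : 2 `^ (n.+1%:R / k.+1%:R) = #|G|%:R `^ (1 / k.+1%:R)); last first.
    by rewrite cG -powR_mulrn// -powRrM mul1r.
  apply: sum_distinct_bound => //.
  + by rewrite -(ltr0n R) cG exprn_gt0.
  + by rewrite cG (le_trans powle)// ler_weXn2l// ler1n.
  + exact: balanced_all.
  + move=> A B _ _; apply: da; rewrite inE lam1 mul1r ler_nat.
      by rewrite -[leqRHS]card_ord max_card.
    by rewrite -[leqRHS]card_ord max_card.
- pose G := half_family 'I_n.+1 ord0.
  have cG : #|G|%:R = 2 ^+ n :> R.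
    have := card_half_family R 'I_n.+1 ord0; rewrite card_ord exprS.
    by apply: mulfI; rewrite pnatr_eq0.
  rewrite (_ : 2 `^ ((n.+1%:R - 1) / k.+1%:R) = #|G|%:R `^ (1 / k.+1%:R)); last first.
    by rewrite cG -powR_mulrn// -powRrM mul1r -[n.+1%:R]natr1 addrK.
  apply: sum_distinct_bound => //.
  + by rewrite -(ltr0n R) cG exprn_gt0.
  + by rewrite cG.
  + exact: balanced_half.
  + have sub A : A \in G -> A \in small_subsets lam n.+1.
      move=> AG; rewrite inE.
      have A2 : (#|A|.*2 <= n.+1)%N.
        by move: AG; rewrite inE card_ord => /orP[/ltnW//|/andP[/eqP->]].
      have := A2; rewrite -(ler_nat R) -mul2n natrM => A2R.
      have n0 : 0 <= n.+1%:R :> R by [].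
      have /andP[l _] := hlam; have := ler_wpM2r n0 l; lra.
    by move=> A B AG BG; apply: da; exact: sub.
Qed.
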